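(* The set $\{\beta^k G^{(\beta)}_a : k\in\mathbb{Z}_{\ge0},\ a \text{ a composition with } \ell(a)\le n\}$ (including the empty composition) is a $\mathbb{Z}$-basis of $\mathrm{QSym}_n[\beta]$. Consequently $\{G^{(-1)}_a : \ell(a)\le n\}$ is a $\mathbb{Z}$-basis of $\mathrm{QSym}_n$.
   Context: $\mathrm{QSym}_n\subseteq\mathbb{Z}[x_1,\dots,x_n]$ is the subring of quasisymmetric polynomials: those in which the coefficients of $x_{i_1}^{e_1}\cdots x_{i_k}^{e_k}$ and $x_{j_1}^{e_1}\cdots x_{j_k}^{e_k}$ agree for all $i_1<\dots<i_k$ and $j_1<\dots<j_k$; $\mathrm{QSym}_n[\beta]$ is polynomials in formal $\beta$ with coefficients in it. Compositions have positive entries; $\ell(a)$ is the length; $0^m a$ prepends $m$ zeros. Glides: a weak komposition is a weak composition whose positive entries are colored black or red, $\mathrm{ex}$ = number of red entries, $\mathtt{flat}$ = nonzero entries. For a weak composition $a'$ of length $n$ with nonzero entries exactly at $n_1<\dots<n_\ell$, a weak komposition $b$ of length $n$ is a glide of $a'$ if there exist $0=i_0<\dots<i_\ell$ with $i_j\le n_j$, $b_k=0$ for $k>i_\ell$, and for each $j$: $b_{i_{j-1}+1}+\dots+b_{i_j}=\mathtt{flat}(a')_j+\#\{\text{red entries among them}\}$ and the first nonzero entry among them is black. $\mathcal{G}^{(\beta)}_{a'}=\sum_b\beta^{\mathrm{ex}(b)}x^b$ over glides $b$ of $a'$. For a composition $a$ with $\ell(a)\le n$, $G^{(\beta)}_a(x_1,\dots,x_n)=\mathcal{G}^{(\beta)}_{0^{n-\ell(a)}a}$.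 *)

(* Defs.v *)
(* Polynomials are encoded by their coefficient functions. *)
From HB Require Import structures.
From mathcomp Require Import all_boot all_order all_algebra.
Set Implicit Arguments. Unset Strict Implicit. Unset Printing Implicit Defensive.
Import Order.TTheory GRing.Theory Num.Theory.

Definition flat (s : seq nat) : seq nat := [seq x <- s | x != 0%N].
(* 0-based positions of the nonzero entries of s (n_j = (nth j).+1 in 1-based) *)
Definition nzpos (s : seq nat) : seq nat :=
  [seq m <- iota 0 (size s) | nth 0%N s m != 0%N].

(* ---------- glides ----------
   A weak komposition of length n = size a' is encoded by its underlying weak
   composition b (a seq nat of size n) and its colouring r : 'I_n -> bool
   (true = red); zero entries must be uncoloured (encoded r m = false).
   glideb a' b r : the komposition (b,r) is a glide of a'.  All indices are
   0-based: 1-based block j = {i_(j-1)+1, ..., i_j} is 0-based [i_(j-1), i_j). *)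
Definition glideb (a' : seq nat) (b : seq nat)
    (r : {ffun 'I_(size a') -> bool}) : bool :=
  [exists i : {ffun 'I_(size (flat a')).+1 -> 'I_(size a').+1},
    [&& (val (i ord0) == 0%N),
        [forall j : 'I_(size (flat a')),
          [&& val (i (widen_ord (leqnSn _) j)) < val (i (lift ord0 j)),
              val (i (lift ord0 j)) <= (nth 0%N (nzpos a') j).+1,
              (\sum_(m < size a' | val (i (widen_ord (leqnSn _) j)) <= m
                                   < val (i (lift ord0 j))) nth 0%N b m
                == nth 0%N (flat a') j
                   + \sum_(m < size a' | val (i (widen_ord (leqnSn _) j)) <= m
                                   < val (i (lift ord0 j))) nat_of_bool (r m))%N &
              [forall m : 'I_(size a'),
                 [&& val (i (widen_ord (leqnSn _) j)) <= m < val (i (lift ord0 j)),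
                     nth 0%N b m != 0%N &
                     [forall m' : 'I_(size a'),
                        (val (i (widen_ord (leqnSn _) j)) <= m' < m)
                          ==> (nth 0%N b m' == 0%N)]]
                 ==> ~~ r m]]] &
        [forall m : 'I_(size a'), (val (i ord_max) <= m) ==> (nth 0%N b m == 0%N)]]].

Arguments glideb : clear implicits.

(* Coefficient of x^e beta^k in the glide polynomial \mathcal{G}^{(beta)}_{a'}:
   the number of glides of a' with underlying weak composition e and ex = k. *)
Definition Gcoef (a' : seq nat) (e : seq nat) (k : nat) : nat :=
  if size e == size a' then
    #|[set r : {ffun 'I_(size a') -> bool} |
        [&& [forall m, r m ==> (0 < nth 0%N e m)%N], glideb a' e r &
            ((\sum_m nat_of_bool (r m))%N == k)]]|
  else 0%N.

Definition pad (n : nat) (a : seq nat) : seq nat := nseq (n - size a) 0%N ++ a.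

Local Open Scope ring_scope.

(* ---------- Z[x_1..x_n][beta] and QSym_n[beta] ----------
   An element is a coefficient function f : (exponent vector, beta-degree) -> int
   with finite support on exponent vectors of length n. *)
Definition is_polyB (n : nat) (f : seq nat * nat -> int) : Prop :=
  exists B : nat, forall x, f x != 0 ->
    [/\ size x.1 = n, all (fun y => y <= B)%N x.1 & (x.2 <= B)%N].
Definition is_qsymB (n : nat) (f : seq nat * nat -> int) : Prop :=
  is_polyB n f /\
  forall e e' k, size e = n -> size e' = n -> flat e = flat e' -> f (e, k) = f (e', k).

Definition is_poly (n : nat) (f : seq nat -> int) : Prop :=
  exists B : nat, forall e, f e != 0 -> size e = n /\ all (fun y => y <= B)%N e.
Definition is_qsym (n : nat) (f : seq nat -> int) : Prop :=
  is_poly n f /\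
  forall e e', size e = n -> size e' = n -> flat e = flat e' -> f e = f e'.

Definition is_composition (a : seq nat) : bool := all (fun x => 0 < x)%N a.

Definition validB (n : nat) (p : nat * seq nat) : bool :=
  is_composition p.2 && (size p.2 <= n)%N.
Definition betaG (n : nat) (p : nat * seq nat) (x : seq nat * nat) : int :=
  if (p.1 <= x.2)%N then (Gcoef (pad n p.2) x.1 (x.2 - p.1))%:Z else 0.

Definition validC (n : nat) (a : seq nat) : bool :=
  is_composition a && (size a <= n)%N.
(* G^{(-1)}_a(x_1..x_n); ex of a komposition of length n is at most n *)
Definition Gminus1 (n : nat) (a : seq nat) (e : seq nat) : int :=
  \sum_(k < n.+1) (-1) ^+ k * (Gcoef (pad n a) e k)%:Z.

Definition is_Zbasis (I : eqType) (X : Type) (valid : pred I) (v : I -> X -> int)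
    (space : (X -> int) -> Prop) : Prop :=
  [/\ forall i, valid i -> space (v i),
      forall f, space f -> exists (L : seq I) (lam : I -> int),
        all valid L /\ forall x, f x = \sum_(i <- L) lam i * v i x
    & forall (L : seq I) (lam : I -> int), uniq L -> all valid L ->
        (forall x, \sum_(i <- L) lam i * v i x = 0) ->
        forall i, i \in L -> lam i = 0].

(* Main.v *)
(** The coefficient of [x^e] in [G_a] depends only on the list of coloured
    nonzero entries of [e], which gives quasisymmetry.  Every block of a glide
    contains a nonzero entry, so [flat e] is at least as long as [a]; if the
    lengths agree, every block is a single black entry and [flat e = a].  Hence
    the [G_a] are unitriangular, for the order by length, with respect to the
    coefficients at the monomials [x^(0^m a)].  These coefficients determine a
    quasisymmetric polynomial and the length is bounded by [n], so
    elimination length by length gives a basis.  The same triangularity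
    holds with formal [beta] and for [beta = -1]. *)
Require Import Defs.
From HB Require Import structures.
From mathcomp Require Import all_boot all_order all_algebra.
From mathcomp Require Import zify.
Set Implicit Arguments. Unset Strict Implicit. Unset Printing Implicit Defensive.
Import Order.TTheory GRing.Theory Num.Theory.

(** * Splitting and slicing lists *)

Lemma filter_eq_cat (T : Type) (P : pred T) (s s1 s2 : seq T) :
  filter P s = s1 ++ s2 ->
  exists t1 t2, [/\ s = t1 ++ t2, filter P t1 = s1 & filter P t2 = s2].
Proof.
elim: s s1 => [|x s IHs] s1 /=.
  by case: s1 => //= <-; exists [::], [::].
case Px: (P x); last first.
  by move=> /IHs[t1 [t2 [-> <- <-]]]; exists (x :: t1), t2; split; rewrite //= Px.
case: s1 => [|y s1] /=.
  by move=> <-; exists [::], (x :: s); rewrite /= Px.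
by case=> <- /IHs[t1 [t2 [-> <- <-]]]; exists (x :: t1), t2; rewrite /= Px.
Qed.

Lemma drop_take_drop (T : Type) (p q : nat) (s : seq T) :
  p <= q -> drop p (take q s) ++ drop q s = drop p s.
Proof.
move=> le_pq; rewrite -{3}(cat_take_drop q s) drop_cat size_take_min.
case: ltnP => // le_mp; rewrite [drop p _]drop_oversize ?size_take_min //=.
case: (leqP (size s) q) => [le_sq|lt_qs]; first by rewrite drop_oversize.
by move: le_mp; rewrite (minn_idPl (ltnW lt_qs)) => le_qp;
  rewrite (_ : p - q = 0) ?drop0 //; apply/eqP.
Qed.

Lemma drop_take_catl (T : Type) (p q : nat) (u v : seq T) :
  drop (size u + p) (take (size u + q) (u ++ v)) = drop p (take q v).
Proof.
by rewrite take_cat ltnNge leq_addr addKn drop_cat ltnNge leq_addr addKn.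
Qed.

Lemma nth_drop_take (T : Type) (d : T) (p q m : nat) (s : seq T) :
  p + m < q -> nth d (drop p (take q s)) m = nth d s (p + m).
Proof. by move=> lt_q; rewrite nth_drop nth_take. Qed.

Lemma sumn_drop_take (n p q : nat) (s : seq nat) :
  size s = n -> p <= q -> q <= n ->
  sumn (drop p (take q s)) = \sum_(m < n | p <= m < q) nth 0 s m.
Proof.
move=> szs le_pq le_qn; rewrite sumnE (big_nth 0) size_drop size_takel ?szs //.
rewrite -(big_mkord (fun m => p <= m < q)).
under [RHS]eq_bigl => m do rewrite andbC.
rewrite -big_nat_widenl // -(big_nat_widen p q n xpredT) // -[in RHS](add0n p) big_addn.
apply: eq_big_nat => m /andP[_ lt_m].
by rewrite [m + p]addnC nth_drop_take // -ltn_subRL.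
Qed.

(** * Glides as lists of coloured entries *)

Definition nonzero_entries (w : seq (nat * bool)) := [seq p <- w | p.1 != 0].

Definition komposition (w : seq (nat * bool)) := all (fun p => p.2 ==> (0 < p.1)) w.

(** With the default [(0, false)] a block without nonzero entries passes the colour test; for
    [0 < x] the sum condition excludes such a block. *)
Definition glide_block (x : nat) (u : seq (nat * bool)) :=
  (sumn (unzip1 u) == x + count snd u) &&
  ~~ (head (0, false) (nonzero_entries u)).2.

(* An entry is a pair (value, is it red).  For [a' = 0^m a] the bounds
   [i_j <= n_j] in the definition of a glide are automatic: the [i_j] increase
   strictly and end at most at [n].  Only the splitting into blocks remains. *)
Fixpoint glides (a : seq nat) (w : seq (nat * bool)) : Prop :=
  if a is x :: a' then
    exists u v, [/\ w = u ++ v, glide_block x u & glides a' v]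
  else all (fun p => p.1 == 0) w.

Lemma count_nonzero_entries w :
  komposition w -> count snd (nonzero_entries w) = count snd w.
Proof.
move=> kw; rewrite count_filter; apply: eq_in_count => p /(allP kw) /=.
by case: p => [[|x']] [].
Qed.

Lemma glide_block_nonzero x u :
  komposition u -> glide_block x (nonzero_entries u) = glide_block x u.
Proof.
move=> ku; rewrite /glide_block {3}/nonzero_entries filter_id count_nonzero_entries //.
congr (_ && _); congr (_ == _); elim: {ku} u => //= [[[|y] c] u /= ->] //.
Qed.

(** Deleting zeros keeps the sum, the red count (no zero is red) and the first nonzero entry of a
    block, and every cut of the filtered list lifts to a cut of [w]. Quasisymmetry rests on this. *)
Lemma glides_nonzero a w :
  komposition w -> glides a w <-> glides a (nonzero_entries w).
Proof.
elim: a w => [|x a IHa] w kw /=.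
  by rewrite all_filter; split=> /allP h; apply/allP => p /h /=; case: (p.1 == 0).
split=> [[u [v [def_w blk gv]]]|[u' [v' [/filter_eq_cat[u [v [def_w <- <-]]]]]]];
  move: kw; rewrite def_w /komposition all_cat => /andP[ku kv].
  exists (nonzero_entries u), (nonzero_entries v).
  by split; [exact: filter_cat | rewrite glide_block_nonzero | exact/(IHa _ kv)].
rewrite -/(nonzero_entries u) glide_block_nonzero // => blk gv.
by exists u, v; split; [| | exact/(IHa _ kv)].
Qed.

(** Add the sum conditions of all blocks. The number of red entries is thus determined by the
    degrees. *)
Lemma glides_sum a w :
  komposition w -> glides a w -> sumn (unzip1 w) = sumn a + count snd w.
Proof.
elim: a w => [|x a IHa] w /=.
  rewrite add0n; elim: w => //= [[y c] w IHw] /= /andP[hc kw] /andP[/eqP y0 zw].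
  by rewrite IHw // y0 in hc *; case: c hc.
move=> kw [u [v [def_w /andP[/eqP blk _] /IHa gv]]].
move: kw; rewrite def_w /komposition all_cat => /andP[ku kv].
by rewrite /unzip1 map_cat sumn_cat -!/(unzip1 _) blk gv // count_cat; lia.
Qed.

Lemma glide_block_neq0 x u : 0 < x -> glide_block x u -> 0 < size u.
Proof. by case: u => // x_gt0 /andP[/eqP /=]; case: x x_gt0. Qed.

(** Blocks are nonempty, so [w] has at least [size a] entries. A block with a single entry has that
    entry as its first nonzero one, hence black, and its sum condition makes the entry equal to the
    part of [a]. *)
Lemma glides_size a w :
    is_composition a -> all (fun p => p.1 != 0) w -> glides a w ->
  size a < size w \/ unzip1 w = a.
Proof.
elim: a w => [|x a IHa] w /=; first by case: w => [|p w]; [right | left].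
move=> /andP[x_gt0 ca] pw [u [v [def_w blk gv]]].
move: pw; rewrite def_w all_cat => /andP[pu pv].
have := glide_block_neq0 x_gt0 blk; case: u pu blk {def_w} => //= p [|q u] /=.
  rewrite andbT /glide_block /= => p_neq0; rewrite p_neq0 /= => /andP[/eqP hs hc] _.
  have -> : p.1 = x by move: hs hc; case: p.2 => //; rewrite !addn0.
  by case: (IHa v ca pv gv) => [|->]; [left | right].
move=> _ _ _; left; rewrite size_cat.
by case: (IHa v ca pv gv) => [|<-]; rewrite /unzip1 ?size_map /=; lia.
Qed.

Lemma glides_refl a : is_composition a -> glides a [seq (x, false) | x <- a].
Proof.
elim: a => //= x a IHa /andP[x_gt0 /IHa ga].
exists [:: (x, false)], [seq (x, false) | x <- a]; split=> //.
by rewrite /glide_block /= !addn0 eqxx; case: (x != 0).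
Qed.

(** * Glides through cut positions *)

Definition glide_cuts (a : seq nat) (w : seq (nat * bool)) (i : nat -> nat) :=
  [/\ i 0 = 0,
      forall j, j < size a ->
        i j < i j.+1 /\ glide_block (nth 0 a j) (drop (i j) (take (i j.+1) w)),
      i (size a) <= size w & all (fun p => p.1 == 0) (drop (i (size a)) w)].

Lemma glides_cuts a w :
  is_composition a -> glides a w <-> exists i, glide_cuts a w i.
Proof.
move=> ca; split; last first.
  (* The induction peels off the first block and shifts [i], so the starting position [i 0] has to
     be arbitrary. *)
  case=> i [i0 blk _ zi]; suff: glides a (drop (i 0) w) by rewrite i0 drop0.
  elim: a i blk zi {ca i0} => [|x a IHa] i blk //= zi.
  exists (drop (i 0) (take (i 1) w)), (drop (i 1) w).
  have [lt_i b0] := blk 0 isT; rewrite drop_take_drop 1?ltnW //; split=> //.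
  by apply: (IHa (i \o S)) => // j lt_j; apply: (blk j.+1).
elim: a ca w => [_ w zw|x a IHa /= /andP[x_gt0 ca] w [u [v [-> blk]]]].
  by exists (fun=> 0); split; rewrite ?drop0.
move=> /(IHa ca)[i [i0 bi le_i zi]].
exists (fun j => if j is j'.+1 then size u + i j' else 0); split=> //=.
- case=> [_|j /bi[lt_i bj]] /=; last by rewrite ltn_add2l drop_take_catl.
  rewrite i0 addn0 drop0 take_size_cat //; split=> //.
  exact: glide_block_neq0 blk.
- by rewrite size_cat leq_add2l.
- by rewrite drop_cat ltnNge leq_addr addKn.
Qed.

(** Rephrases the colour test by positions, the form used in [glideb]. *)
Lemma head_nonzeroP (u : seq (nat * bool)) :
  reflect (forall m, m < size u -> (nth (0, false) u m).1 != 0 ->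
             (forall m', m' < m -> (nth (0, false) u m').1 = 0) ->
             ~~ (nth (0, false) u m).2)
          (~~ (head (0, false) (nonzero_entries u)).2).
Proof.
elim: u => [|p u IHu] /=; first by apply: ReflectT.
have [p0|p_neq0] /= := eqVneq p.1 0; last first.
  apply: (iffP idP) => [hp [|m] //= _ _ /(_ 0 isT)|/(_ 0)]; last exact.
  by move/eqP: p_neq0.
apply: (iffP IHu) => h m.
  case: m => [|m] /=; first by rewrite p0.
  by move=> lt_m nz z; apply: h => // m' lt_m'; apply: (z m'.+1).
by move=> lt_m nz z; apply: (h m.+1) => // -[|m'] //; apply: z.
Qed.


Lemma nth_codom_ord n (r : {ffun 'I_n -> bool}) (m : 'I_n) :
  nth false (codom r) m = r m.
Proof. by rewrite (nth_map m) ?size_enum_ord // nth_ord_enum. Qed.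

Lemma size_codom_ord n (r : {ffun 'I_n -> bool}) : size (codom r) = n.
Proof. by rewrite size_codom card_ord. Qed.

Lemma glide_block_slice n (e : seq nat) (r : {ffun 'I_n -> bool}) x p q :
  size e = n -> p <= q -> q <= n ->
  glide_block x (drop p (take q (zip e (codom r)))) =
  (\sum_(m < n | p <= m < q) nth 0 e m
     == x + \sum_(m < n | p <= m < q) nat_of_bool (r m)) &&
  [forall m : 'I_n,
     [&& p <= m < q, nth 0 e m != 0
       & [forall m' : 'I_n, (p <= m' < m) ==> (nth 0 e m' == 0)]] ==> ~~ r m].
Proof.
move=> sze le_pq le_qn; have szr := size_codom_ord r.
have szw : size (zip e (codom r)) = n by rewrite size_zip sze szr minnn.
congr andb.
  rewrite /unzip1 map_drop map_take -/(unzip1 _) unzip1_zip ?sze ?szr //.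
  rewrite (sumn_drop_take sze) //; congr (_ == _ + _).
  rewrite -sumn_count (map_comp _ snd) map_drop map_take -/(unzip2 _).
  rewrite unzip2_zip ?sze ?szr // map_drop map_take.
  rewrite (@sumn_drop_take n) //; last by rewrite size_map.
  by apply: eq_bigr => m _; rewrite (nth_map false) ?szr // nth_codom_ord.
have nthw m : p + m < q -> nth (0, false) (drop p (take q (zip e (codom r)))) m
    = (nth 0 e (p + m), nth false (codom r) (p + m)).
  by move=> lt_q; rewrite nth_drop_take // nth_zip // sze szr.
have szu : size (drop p (take q (zip e (codom r)))) = q - p.
  by rewrite size_drop size_takel ?szw.
apply/idP/idP => [/head_nonzeroP h|/forallP h].
  apply/forallP=> m; apply/implyP=> /and3P[/andP[le_pm lt_mq] nz /forallP z].
  have := h (m - p); rewrite szu nthw subnKC //= nth_codom_ord => -> //.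
    by rewrite ltn_sub2r // (leq_ltn_trans le_pm).
  move=> m' lt_m'; have lt_pm' : p + m' < m by rewrite -ltn_subRL.
  rewrite nthw ?(ltn_trans lt_pm') //=.
  have lt_n : p + m' < n by rewrite (ltn_trans lt_pm').
  by have /implyP/(_ _)/eqP := z (Ordinal lt_n); apply; rewrite /= leq_addr.
apply/head_nonzeroP => m; rewrite szu => lt_m.
have lt_pm : p + m < q by rewrite -ltn_subRL.
rewrite nthw //= => nz z; have lt_n := leq_trans lt_pm le_qn.
have := h (Ordinal lt_n); rewrite -(nth_codom_ord r (Ordinal lt_n)) /=.
move/implyP; apply; rewrite leq_addr lt_pm nz /=.
apply/forallP=> m'; apply/implyP=> /andP[le_pm' lt_m'].
have lt' : m' - p < m by lia.
by have := z _ lt'; rewrite nthw /= subnKC // => [->|]; last lia.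
Qed.

Lemma flat_composition s : is_composition (flat s).
Proof. by apply/allP => x; rewrite mem_filter lt0n => /andP[]. Qed.

(** The hypothesis on [nzpos] places the nonzero entries of [a'] at the end, as in [0^m a]. One
    direction forgets the bounds on the cuts, the other recovers them from strict monotonicity. *)
Lemma glidebP (a' e : seq nat) (r : {ffun 'I_(size a') -> bool}) :
    size e = size a' ->
    nzpos a' = iota (size a' - size (flat a')) (size (flat a')) ->
  glideb a' e r <-> glides (flat a') (zip e (codom r)).
Proof.
set n := size a'; set a := flat a' => sze nzpos_a.
have szr := size_codom_ord r.
have szw : size (zip e (codom r)) = n by rewrite size_zip sze szr minnn.
have le_an : size a <= n by rewrite size_filter count_size.
have zeroE p : all (fun x => x.1 == 0) (drop p (zip e (codom r))) <->
    [forall m : 'I_n, (p <= m) ==> (nth 0 e m == 0)].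
  split=> [/(all_nthP (0, false)) z|/forallP z].
    apply/forallP=> m; apply/implyP=> le_pm.
    have := z (m - p); rewrite size_drop szw ltn_sub2r ?(leq_ltn_trans le_pm) //.
    by rewrite nth_drop subnKC // nth_zip ?sze ?szr //; apply.
  apply/(all_nthP (0, false)) => m; rewrite size_drop szw ltn_subRL => lt_n.
  by have := z (Ordinal lt_n); rewrite /= leq_addr nth_drop nth_zip ?sze ?szr.
rewrite (glides_cuts _ (flat_composition a')); split.
  case/existsP=> i /and3P[/eqP i0 /forallP blk /zeroE z].
  (* [inord] extends the finite function to all of [nat]; only the values up to [size a] matter. *)
  exists (fun j => val (i (inord j))); split.
  - by rewrite -[RHS]i0; congr (val (i _)); apply: val_inj; rewrite /= inordK.
  - move=> j lt_j; have /and4P[] := blk (Ordinal lt_j).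
    have -> : widen_ord (leqnSn (size (flat a'))) (Ordinal lt_j) = inord j.
      by apply: val_inj; rewrite /= inordK // ltnW.
    have -> : lift ord0 (Ordinal lt_j) = inord j.+1.
      by apply: val_inj; rewrite /= inordK.
    move=> lt_i _ sums black; split=> //.
    rewrite (glide_block_slice r _ sze (ltnW lt_i)) -1?ltnS ?ltn_ord //.
    exact/andP.
  - by rewrite szw -ltnS ltn_ord.
  - have -> : inord (size a) = ord_max :> 'I_(size a).+1.
      by apply: val_inj; rewrite /= inordK.
    exact: z.
case=> i [i0 blk]; rewrite szw => le_in z.
(* At least one position is consumed by each of the [size a - j] blocks after the cut [i j]. *)
have le_i j : j <= size a -> i j + (size a - j) <= n.
  move=> le_j; apply: leq_trans le_in.
  rewrite -{2}(subnKC le_j); move: (size a - j) (subnKC le_j) => d.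
  elim: d => [|d IHd] in j le_j *; first by rewrite !addn0.
  move=> def_a; have lt_j : j < size a by lia.
  have [lt_i _] := blk j lt_j; have := IHd j.+1 lt_j.
  by rewrite addSnnS => /(_ def_a); lia.
have iE (j : 'I_(size a).+1) :
    val ([ffun j : 'I_(size a).+1 => inord (i j) : 'I_n.+1] j) = i j.
  by rewrite ffunE /= inordK // ltnS; have := le_i j (leq_ord j); lia.
apply/existsP; exists [ffun j : 'I_(size a).+1 => inord (i j)]; apply/and3P; split.
- by rewrite iE i0.
- apply/forallP=> j; rewrite !iE /= /bump /= add1n.
  have [lt_i b] := blk j (ltn_ord j); have le_i' := le_i _ (ltn_ord j).
  rewrite lt_i nzpos_a nth_iota //=.
  move: b; rewrite (glide_block_slice r _ sze (ltnW lt_i)); last by lia.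
  case/andP=> -> ->; rewrite !andbT.
  have arith (x k s m : nat) : x + (s - k.+1) <= m -> k < s -> x <= (m - s + k).+1.
    by lia.
  exact: arith le_i' (ltn_ord j).
- by rewrite iE /=; apply/zeroE.
Qed.

(* Inverse of reading off the colours of the nonzero entries: carrying colours
   from [e] to [e'] with [flat e = flat e'] is the bijection behind
   quasisymmetry. *)
Fixpoint spread (e : seq nat) (d : seq bool) : seq bool :=
  if e is y :: e' then
    if y == 0 then false :: spread e' d else head false d :: spread e' (behead d)
  else [::].

Lemma size_spread e d : size (spread e d) = size e.
Proof. by elim: e d => //= y e IHe d; case: ifP => _; rewrite /= IHe. Qed.

Lemma nonzero_zip_spread e d :
  size d = size (flat e) -> nonzero_entries (zip e (spread e d)) = zip (flat e) d.
Proof.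
rewrite /nonzero_entries; elim: e d => [|y e IHe] d /=; first by case: d.
have [->|y_neq0] /= := eqVneq y 0; first exact: IHe.
by case: d => //= c d [/IHe->]; rewrite y_neq0.
Qed.

Lemma komposition_spread e d : komposition (zip e (spread e d)).
Proof. by elim: e d => //= [[|y] e IHe] d /=; rewrite ?implybT IHe. Qed.

Lemma unzip1_nonzero_zip e c :
  size c = size e -> unzip1 (nonzero_entries (zip e c)) = flat e.
Proof.
rewrite /nonzero_entries.
by elim: e c => [|y e IHe] [|b c] //= [/IHe szc]; case: eqP => //= _; rewrite szc.
Qed.

(** Zeros of a komposition are never red, so the colours of the nonzero entries determine the whole
    colouring. *)
Lemma spreadK e c : size c = size e -> komposition (zip e c) ->
  spread e (unzip2 (nonzero_entries (zip e c))) = c.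
Proof.
rewrite /nonzero_entries.
elim: e c => [|y e IHe] [|b c] //= [szc] /andP[/= hb kc].
by case: eqP hb => [->|_ _] /=; rewrite IHe //; case: b.
Qed.

(** * Coefficients of the glide polynomials *)

Section GlideCoefficients.

Variables (n : nat) (a : seq nat).
Hypotheses (comp_a : is_composition a) (le_an : size a <= n).

Lemma size_pad : size (pad n a) = n.
Proof. by rewrite size_cat size_nseq subnK. Qed.

Lemma flat_pad : flat (pad n a) = a.
Proof.
rewrite /flat filter_cat filter_nseq /= (all_filterP _) //.
by apply: sub_all comp_a => x; rewrite lt0n.
Qed.

Lemma nzpos_pad :
  nzpos (pad n a) = iota (size (pad n a) - size (flat (pad n a))) (size (flat (pad n a))).
Proof.
rewrite flat_pad size_pad /nzpos size_pad -[in iota 0 n](subnK le_an) iotaD filter_cat.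
rewrite (@eq_in_filter _ _ pred0) ?filter_pred0; last first.
  by move=> m; rewrite mem_iota /= nth_cat size_nseq nth_nseq => ->.
apply/all_filterP/allP => m; rewrite mem_iota add0n subnK // => /andP[le_m lt_m].
rewrite nth_cat size_nseq ltnNge le_m /= -lt0n (allP comp_a) // mem_nth //.
by rewrite ltn_subLR // subnK.
Qed.

Lemma Gcoef_size e k : size e != n -> Gcoef (pad n a) e k = 0.
Proof.
move=> ne_sz; rewrite /Gcoef; case: eqP => // sze.
by rewrite sze size_pad eqxx in ne_sz.
Qed.

Definition glide_colorings e k : {set {ffun 'I_(size (pad n a)) -> bool}} :=
  [set r : {ffun 'I_(size (pad n a)) -> bool} |
    [&& [forall m, r m ==> (0 < nth 0 e m)], glideb (pad n a) e r
      & \sum_m nat_of_bool (r m) == k]].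

Lemma Gcoef_card e k :
  size e = n -> Gcoef (pad n a) e k = #|glide_colorings e k|.
Proof. by move=> sze; rewrite /Gcoef; case: eqP => // -[]; rewrite size_pad. Qed.

Lemma glide_coloringsP e k (r : {ffun 'I_(size (pad n a)) -> bool}) : size e = n ->
  let w := zip e (codom r) in
  r \in glide_colorings e k <-> [/\ komposition w, glides a w & count snd w = k].
Proof.
move=> sze w; have szr : size (codom r) = size e.
  by rewrite size_codom_ord size_pad sze.
have glideP : glideb (pad n a) e r <-> glides a w.
  by rewrite -{2}flat_pad; apply: glidebP nzpos_pad; rewrite size_pad.
have -> : count snd w = \sum_m nat_of_bool (r m).
  rewrite -sumn_count (map_comp nat_of_bool snd) -/(unzip2 _) unzip2_zip ?szr //.
  by rewrite sumnE big_map /codom big_image.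
have kompE : [forall m, r m ==> (0 < nth 0 e m)] = komposition w.
  apply/forallP/(all_nthP (0, false)) => [h m|h m]; last first.
    have := h m; rewrite size_zip szr minnn nth_zip //= nth_codom_ord; apply.
    by rewrite sze -{2}size_pad.
  rewrite size_zip szr minnn sze -{1}size_pad => lt_m; rewrite nth_zip //=.
  by have := h (Ordinal lt_m); rewrite -(nth_codom_ord r (Ordinal lt_m)).
rewrite inE kompE; split=> [/and3P[-> /glideP ? /eqP]|[-> /glideP -> ->]] //.
by rewrite eqxx.
Qed.

(** Colours are carried from [e] to [e'] along the nonzero entries. The coloured nonzero entries
    stay the same, so glides go to glides with equal red count, and carrying back is a left inverse,
    so the map is injective. Exchanging [e] and [e'] then yields equality. *)
Lemma Gcoef_flat_leq e e' k : size e = n -> size e' = n -> flat e = flat e' ->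
  Gcoef (pad n a) e k <= Gcoef (pad n a) e' k.
Proof.
move=> sze sze' eq_flat; rewrite !Gcoef_card //.
pose reds f (r : {ffun 'I_(size (pad n a)) -> bool}) :=
  unzip2 (nonzero_entries (zip f (codom r))).
pose phi f f' (r : {ffun 'I_(size (pad n a)) -> bool}) :=
  [ffun m : 'I_(size (pad n a)) => nth false (spread f' (reds f r)) m].
have codom_phi f f' r : size f' = n -> codom (phi f f' r) = spread f' (reds f r).
  move=> szf'; apply: (@eq_from_nth _ false).
    by rewrite size_codom card_ord size_spread size_pad szf'.
  rewrite size_codom card_ord => m lt_m.
  by rewrite (nth_codom_ord (phi f f' r) (Ordinal lt_m)) ffunE.
have szr (r : {ffun 'I_(size (pad n a)) -> bool}) : size (codom r) = size e.
  by rewrite size_codom_ord size_pad sze.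
have nz_phi r : nonzero_entries (zip e' (codom (phi e e' r))) =
                nonzero_entries (zip e (codom r)).
  have sz1 := unzip1_nonzero_zip (szr r).
  rewrite codom_phi // nonzero_zip_spread; last first.
    by rewrite -eq_flat -sz1 !size_map.
  by rewrite -eq_flat -sz1 zip_unzip.
have phiK : {in glide_colorings e k, cancel (phi e e') (phi e' e)}.
  move=> r /(glide_coloringsP _ _ sze)[kw _ _]; apply/ffunP=> m.
  by rewrite ffunE /reds nz_phi spreadK // nth_codom_ord.
rewrite -(card_in_imset (can_in_inj phiK)); apply/subset_leq_card/subsetP.
move=> _ /imsetP[r /(glide_coloringsP _ _ sze)[kw gw kE] ->].
apply/(glide_coloringsP _ _ sze').
have kw' : komposition (zip e' (codom (phi e e' r))).
  by rewrite codom_phi // komposition_spread.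
split=> //; last by rewrite -count_nonzero_entries // nz_phi count_nonzero_entries.
by apply/(glides_nonzero _ kw'); rewrite nz_phi; apply/(glides_nonzero _ kw).
Qed.

Lemma Gcoef_flat e e' k : size e = n -> size e' = n -> flat e = flat e' ->
  Gcoef (pad n a) e k = Gcoef (pad n a) e' k.
Proof. by move=> *; apply/eqP; rewrite eqn_leq !Gcoef_flat_leq. Qed.

Lemma Gcoef_neq0 e k : Gcoef (pad n a) e k != 0 ->
  [/\ size e = n, k <= n, sumn e = sumn a + k
    & size a < size (flat e) \/ flat e = a].
Proof.
have [sze|/Gcoef_size->//] := eqVneq (size e) n.
rewrite Gcoef_card // cards_eq0 => /set0Pn[r /(glide_coloringsP _ _ sze)].
set w := zip _ _ => -[kw gw kE].
have szr : size (codom r) = size e by rewrite size_codom_ord size_pad sze.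
have w1 : unzip1 w = e by rewrite unzip1_zip ?szr.
have wn : unzip1 (nonzero_entries w) = flat e by rewrite unzip1_nonzero_zip ?szr.
split=> //.
- by rewrite -kE -sze -w1 size_map count_size.
- by rewrite -kE -(glides_sum kw gw) w1.
have := glides_size comp_a (filter_all _ _) (proj1 (glides_nonzero a kw) gw).
by rewrite -wn size_map.
Qed.

Lemma sumn_flat e : sumn (flat e) = sumn e.
Proof. by elim: e => //= -[|y] e /= ->. Qed.

(** If [flat e = a], then [e] and [a] have equal sums, and the degree equation forces [k = 0]. *)
Lemma Gcoef_triangular e k : Gcoef (pad n a) e k != 0 ->
  size a < size (flat e) \/ flat e = a /\ k = 0.
Proof.
case/Gcoef_neq0=> _ _ sum_e [|flat_e]; [by left | right; split=> //].
by apply/eqP; rewrite -(eqn_add2l (sumn a)) -sum_e addn0 -flat_e sumn_flat.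
Qed.

(** Without red entries only the all-black colouring remains, and it is a glide: after deletion of
    zeros each entry is its own block. *)
Lemma Gcoef_pad : Gcoef (pad n a) (pad n a) 0 = 1.
Proof.
have szp := size_pad; rewrite Gcoef_card //; apply/eqP/cards1P.
exists [ffun=> false]; apply/eqP; rewrite eqEsubset sub1set; apply/andP; split.
  apply/subsetP=> r; rewrite !inE => /and3P[_ _]; rewrite sum_nat_eq0.
  move=> /forall_inP r0; apply/eqP/ffunP => m; rewrite ffunE.
  by have := r0 m isT; case: (r m).
apply/(glide_coloringsP _ _ szp).
have -> : codom ([ffun=> false] : {ffun 'I_(size (pad n a)) -> bool}) =
    nseq (size (pad n a)) false.
  set r := finfun _; rewrite -[in RHS](size_codom_ord r).
  by apply/all_pred1P/allP => _ /codomP[m ->]; rewrite ffunE.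
have w0 s : zip s (nseq (size s) false) = [seq (x, false) | x <- s].
  by elim: s => //= x s ->.
rewrite w0.
have kw (s : seq nat) : komposition [seq (x, false) | x <- s].
  by rewrite /komposition all_map; apply/allP.
split=> //; last by rewrite count_map; apply: count_pred0.
apply/(glides_nonzero _ (kw _)); rewrite /nonzero_entries filter_map.
rewrite (_ : filter _ _ = flat (pad n a)) // flat_pad.
exact: glides_refl.
Qed.

End GlideCoefficients.

(** * Unitriangular bases *)

Local Open Scope ring_scope.

(** The matrix of values [v i (pt j)] is unitriangular for [rk]. Independence: evaluate a relation
    at [pt i], by induction on the rank of [i]. Spanning: clear the values at the test points rank
    by rank; each stage is a finite sum since [f] is nonzero at finitely many of them, and an
    element vanishing at all of them is zero. *)
Lemma unitriangular_Zbasis (I : eqType) (X : Type) (valid : pred I)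
    (v : I -> X -> int) (space : (X -> int) -> Prop)
    (pt : I -> X) (rk : I -> nat) (n : nat) :
    (forall i, valid i -> (rk i <= n)%N) ->
    (forall i, valid i -> space (v i)) ->
    (forall f g h c, space f -> space g -> (forall x, h x = f x - c * g x) ->
       space h) ->
    (forall f, space f -> (forall i, valid i -> f (pt i) = 0) ->
       forall x, f x = 0) ->
    (forall f, space f ->
       exists s : seq I, forall i, valid i -> f (pt i) != 0 -> i \in s) ->
    (forall i, valid i -> v i (pt i) = 1) ->
    (forall i j, valid i -> valid j -> v i (pt j) != 0 ->
       (rk i < rk j)%N \/ i = j) ->
  is_Zbasis valid v space.
Proof.
move=> rk_le space_v spaceB space0 supp v1 tri.
have v0 i j : valid i -> valid j -> (rk j <= rk i)%N -> i != j -> v i (pt j) = 0.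
  move=> vi vj le_ji ne_ij; apply/eqP; apply: contraNT ne_ij.
  by case/(tri _ _ vi vj) => [|->//]; rewrite ltnNge le_ji.
split=> //; last first.
  move=> L lam uL /allP vL sum0 i; have [d] := ubnP (rk i).
  elim: d i => // d IHd i; rewrite ltnS => le_d Li.
  have := sum0 (pt i); rewrite (bigD1_seq i) //= v1 ?vL // mulr1.
  rewrite big_seq_cond big1 ?addr0 // => j /andP[Lj ne_ji].
  have [lt_ji|le_ij] := ltnP (rk j) (rk i).
    by rewrite IHd ?mul0r // (leq_trans lt_ji).
  by rewrite v0 ?mulr0 // vL.
have space_sum f (s : seq I) (lam : I -> int) : space f -> all valid s ->
    space (fun x => f x - \sum_(i <- s) lam i * v i x).
  elim: s => [|i s IHs] sf /=.
    by move=> _; apply: (spaceB f f _ 0) => // x; rewrite big_nil mul0r.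
  move=> /andP[vi vs]; apply: (spaceB _ (v i) _ (lam i) (IHs sf vs) (space_v i vi)).
  by move=> x; rewrite big_cons opprD [- _ - _]addrC addrA.
(* [d] counts the ranks still to be cleared: [f] vanishes at test points of rank at most [n - d],
   and [L] uses higher ranks only. For [d = n.+1] the vanishing condition is void. *)
suff span d f : space f ->
    (forall i, valid i -> (rk i + d <= n)%N -> f (pt i) = 0) ->
    exists (L : seq I) (lam : I -> int),
      [/\ all valid L, all (fun i => (n < rk i + d)%N) L
        & forall x, f x = \sum_(i <- L) lam i * v i x].
  move=> f sf; have [|L [lam [vL _ fE]]] := span n.+1 f sf; last by exists L, lam.
  by move=> i _; rewrite addnS ltnNge leq_addl.
elim: d f => [|d IHd] f sf f0.
  exists [::], (fun=> 0); split=> // x; rewrite big_nil; apply: space0 sf _ x.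
  by move=> i vi; apply: f0; rewrite ?addn0 ?rk_le.
have [s fs] := supp f sf.
pose L0 := undup [seq i <- s | valid i && (rk i + d == n)%N].
have L0P i : i \in L0 = [&& valid i, (rk i + d == n)%N & i \in s].
  by rewrite mem_undup mem_filter andbA.
have vL0 : all valid L0 by apply/allP=> i; rewrite L0P => /and3P[].
(* At test points of rank [n - d] the subtraction cancels the value of [f]; at those of lower rank
   every subtracted term vanishes, so the earlier zeros persist. *)
pose g x := f x - \sum_(i <- L0) f (pt i) * v i x.
have sg : space g by apply: (space_sum f L0 (fun i => f (pt i))).
have [|L [lam [vL rkL gE]]] := IHd g sg.
  move=> j vj le_jn; rewrite /g.
  have v0L i : i \in L0 -> i != j -> f (pt i) * v i (pt j) = 0.
    rewrite L0P => /and3P[vi /eqP rki _] ne_ij; rewrite v0 ?mulr0 //.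
    by rewrite -(leq_add2r d) rki.
  have [jL0|jL0] := boolP (j \in L0).
    rewrite (bigD1_seq j) ?undup_uniq //= v1 // mulr1 big_seq_cond big1.
      by rewrite addr0 subrr.
    by move=> i /andP[]; apply: v0L.
  rewrite big_seq big1 ?subr0 => [|i iL0]; last first.
    by apply: v0L => //; apply: contraNneq jL0 => <-.
  move: le_jn; rewrite leq_eqVlt => /orP[rkj|]; last by rewrite -addnS; apply: f0.
  by apply/eqP; apply: contraNT jL0 => /(fs j vj); rewrite L0P vj rkj.
(* [L0] has rank exactly [n - d] and [L] has higher ranks, so the rank tells which coefficient
   applies. *)
exists (L0 ++ L), (fun i => if (rk i + d == n)%N then f (pt i) else lam i).
split; first by rewrite all_cat vL0.
  rewrite all_cat; apply/andP; split; apply/allP=> i.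
    by rewrite L0P addnS ltnS => /and3P[_ /eqP-> _].
  by move/(allP rkL)=> lt_n; rewrite addnS ltnS ltnW.
move=> x; rewrite big_cat /= -[LHS](subrK (\sum_(i <- L0) f (pt i) * v i x)).
rewrite -/(g x) gE [LHS]addrC; congr (_ + _); apply: eq_big_seq => i.
  by rewrite L0P => /and3P[_ -> _].
by move/(allP rkL); rewrite ltn_neqAle eq_sym => /andP[/negbTE->].
Qed.

(** A finite list containing the support of any polynomial with exponents at most [B]; it supplies
    the finiteness needed for spanning. *)
Fixpoint box_vectors (n B : nat) : seq (seq nat) :=
  if n is n'.+1 then [seq x :: e | x <- iota 0 B.+1, e <- box_vectors n' B]
  else [:: [::]].

Lemma mem_box_vectors n B e :
  size e = n -> all (fun y => y <= B)%N e -> e \in box_vectors n B.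
Proof.
elim: n e => [|n IHn] [|y e] //= [sze] /andP[le_y le_e].
by apply: (allpairs_f _ (s := iota 0 B.+1)); [rewrite mem_iota | apply: IHn].
Qed.

Lemma leq_mem_sumn (x : nat) (s : seq nat) : x \in s -> (x <= sumn s)%N.
Proof.
elim: s => //= y s IHs; rewrite inE => /predU1P[->|/IHs le_x].
  exact: leq_addr.
exact: leq_trans le_x (leq_addl _ _).
Qed.

(** * Quasisymmetric polynomials and the two bases *)

Section QuasisymmetricBases.

Variable n : nat.

(** [pad n (flat e)] is the representative of [e] to which quasisymmetry moves a coefficient. *)
Lemma pad_flat e :
  size e = n -> size (pad n (flat e)) = n /\ flat (pad n (flat e)) = flat e.
Proof.
move=> sze; have le_n : (size (flat e) <= n)%N by rewrite -sze size_filter count_size.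
by rewrite size_pad ?flat_pad ?flat_composition.
Qed.

Lemma Gcoef_bound a e k :
    is_composition a -> (size a <= n)%N -> Gcoef (pad n a) e k != 0%N ->
  [/\ size e = n, all (fun y => y <= sumn a + n)%N e & (k <= n)%N].
Proof.
move=> ca le_an /(Gcoef_neq0 ca le_an)[sze le_kn sum_e _]; split=> //.
apply/allP=> y /leq_mem_sumn le_y; apply: leq_trans le_y _.
by rewrite sum_e leq_add2l.
Qed.

Lemma is_qsymB_lincomb f g h c : is_qsymB n f -> is_qsymB n g ->
  (forall x, h x = f x - c * g x) -> is_qsymB n h.
Proof.
move=> [[B1 fB] fq] [[B2 gB] gq] hE; split; last first.
  by move=> e e' k sze sze' eq_e; rewrite !hE (fq e e') ?(gq e e').
exists (maxn B1 B2) => x; rewrite hE; have [f0|/fB[-> le_e le_k] _] := eqVneq (f x) 0.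
  have [g0|/gB[-> le_e le_k] _] := eqVneq (g x) 0.
    by rewrite f0 g0 mulr0 subrr eqxx.
  split=> //; last by rewrite leq_max le_k orbT.
  by apply: sub_all le_e => y le_y; rewrite leq_max le_y orbT.
split=> //; last by rewrite leq_max le_k.
by apply: sub_all le_e => y le_y; rewrite leq_max le_y.
Qed.

Lemma is_qsym_lincomb f g h c : is_qsym n f -> is_qsym n g ->
  (forall x, h x = f x - c * g x) -> is_qsym n h.
Proof.
move=> [[B1 fB] fq] [[B2 gB] gq] hE; split; last first.
  by move=> e e' sze sze' eq_e; rewrite !hE (fq e e') ?(gq e e').
exists (maxn B1 B2) => x; rewrite hE; have [f0|/fB[-> le_e] _] := eqVneq (f x) 0.
  have [g0|/gB[-> le_e] _] := eqVneq (g x) 0.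
    by rewrite f0 g0 mulr0 subrr eqxx.
  by split=> //; apply: sub_all le_e => y le_y; rewrite leq_max le_y orbT.
by split=> //; apply: sub_all le_e => y le_y; rewrite leq_max le_y.
Qed.

Lemma betaG_qsymB p : validB n p -> is_qsymB n (betaG n p).
Proof.
case: p => k0 a /andP[/= ca le_an]; split; last first.
  by move=> e e' k sze sze' eq_e; rewrite /betaG /= (Gcoef_flat ca le_an _ sze sze' eq_e).
(* Exponents of the variables are at most [sumn a + n], those of beta at most [k0 + n]; the sum
   bounds both. *)
exists (k0 + (sumn a + n))%N => -[e k]; rewrite /betaG /=.
case: ifP => // le_k; rewrite eqz_nat => /(Gcoef_bound ca le_an)[-> le_e le_kn].
split=> //; last by lia.
by apply: sub_all le_e => y le_y; rewrite (leq_trans le_y) ?leq_addl.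
Qed.

Lemma Gminus1_neq0 a e :
  Gminus1 n a e != 0 -> exists k, Gcoef (pad n a) e k != 0%N.
Proof.
move=> G_neq0; suff [k] : exists k : 'I_n.+1, Gcoef (pad n a) e k != 0%N by exists k.
apply/existsP; apply: contraNT G_neq0 => /existsPn G0.
by rewrite /Gminus1 big1 // => k _; have /negPn/eqP-> := G0 k; rewrite mulr0.
Qed.

Lemma Gminus1_qsym a : validC n a -> is_qsym n (Gminus1 n a).
Proof.
case/andP=> ca le_an; split; last first.
  move=> e e' sze sze' eq_e; apply: eq_bigr => k _.
  by rewrite (Gcoef_flat ca le_an _ sze sze' eq_e).
by exists (sumn a + n)%N => e /Gminus1_neq0[k /(Gcoef_bound ca le_an)[]].
Qed.

(** The test point of [beta^k G_a] is the monomial [beta^k x^(0^m a)], and the rank is the length of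
    [a] alone: at equal lengths triangularity also forces equal powers of beta. *)
Lemma betaG_Zbasis : is_Zbasis (validB n) (betaG n) (is_qsymB n).
Proof.
apply: (@unitriangular_Zbasis _ _ _ _ _ (fun p => (pad n p.2, p.1))
  (fun p => size p.2) n).
- by move=> p /andP[].
- exact: betaG_qsymB.
- exact: is_qsymB_lincomb.
- move=> f [[B fB] fq] f0 [e k]; apply/eqP; apply/negPn/negP => fx.
  have [/= sze _ _] := fB _ fx; have [szp flat_p] := pad_flat sze.
  rewrite (fq _ _ k sze szp) // (f0 (k, flat e)) ?eqxx // in fx.
  by rewrite /validB /= flat_composition -sze size_filter count_size.
- move=> f [[B fB] _].
  exists [seq (k, flat e) | k <- iota 0 B.+1, e <- box_vectors n B] => -[k a].
  case/andP=> ca le_an /fB[szp le_p le_k]; rewrite /= in ca le_an szp le_p le_k.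
  apply/allpairsPdep; exists k, (pad n a); rewrite flat_pad // mem_iota ltnS.
  by split=> //; apply: mem_box_vectors.
- by case=> k a /andP[/= ca le_an]; rewrite /betaG /= leqnn subnn Gcoef_pad.
case=> k a [l b] /andP[/= ca le_an] /andP[/= cb le_bn]; rewrite /betaG /=.
case: ifP => // le_kl; rewrite eqz_nat => /(Gcoef_triangular ca le_an).
rewrite flat_pad // => -[|[-> /eqP]]; first by left.
rewrite subn_eq0 => le_lk; right; congr pair.
by apply/eqP; rewrite eqn_leq le_kl.
Qed.

(** The same elimination at beta = -1. A nonzero alternating sum has a nonzero term, so
    triangularity carries over despite the signs. *)
Lemma Gminus1_Zbasis : is_Zbasis (validC n) (Gminus1 n) (is_qsym n).
Proof.
apply: (@unitriangular_Zbasis _ _ _ _ _ (pad n) size n).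
- by move=> p /andP[].
- exact: Gminus1_qsym.
- exact: is_qsym_lincomb.
- move=> f [[B fB] fq] f0 e; apply/eqP; apply/negPn/negP => fx.
  have [/= sze _] := fB _ fx; have [szp flat_p] := pad_flat sze.
  rewrite (fq _ _ sze szp) // (f0 (flat e)) ?eqxx // in fx.
  by rewrite /validC flat_composition -sze size_filter count_size.
- move=> f [[B fB] _]; exists [seq flat e | e <- box_vectors n B] => a.
  case/andP=> ca le_an /fB[szp le_p].
  by rewrite -{1}(flat_pad n ca); apply/map_f/mem_box_vectors.
(* At [x^(0^m a)] only the term [k = 0] survives, and its sign is 1. *)
- move=> a /andP[ca le_an]; rewrite /Gminus1 big_ord_recl Gcoef_pad // mulr1.
  rewrite big1 ?addr0 // => k _; apply/eqP; apply/negPn/negP.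
  rewrite mulf_eq0 negb_or => /andP[_]; rewrite eqz_nat.
  by case/(Gcoef_triangular ca le_an) => [|[]//]; rewrite flat_pad // ltnn.
move=> a b /andP[ca le_an] /andP[cb le_bn] /Gminus1_neq0[k].
case/(Gcoef_triangular ca le_an) => [|[]]; rewrite flat_pad //; first by left.
by move=> ->; right.
Qed.

End QuasisymmetricBases.

Theorem mainTheorem10 (n : nat) :
  is_Zbasis (validB n) (betaG n) (is_qsymB n) /\
  is_Zbasis (validC n) (Gminus1 n) (is_qsym n).
Proof. by split; [apply: betaG_Zbasis | apply: Gminus1_Zbasis]. Qed.
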